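(* Let $k$ be a field of characteristic zero, let $n,e,l,m>1$ be integers, and let $Q(X,Z,T)=T^{m}+f_{1}(X,Z)T^{m-1}+\cdots+f_{m}(X,Z)$ with $f_i\in k[X,Z]$. Let $$B_{n,e,l,Q}=k[X,Y,Z,T]/\langle Y(X^{n}+Z^{e})^{l}-Q(X,Z,T)\rangle ,$$ let $x,y,z,t$ be the images of $X,Y,Z,T$ in $B_{n,e,l,Q}$, and let $\partial$ be the locally nilpotent $k$-derivation of $B_{n,e,l,Q}$ given by $\partial(x)=\partial(z)=0$, $\partial(y)=\frac{\partial Q}{\partial T}(x,z,t)$, $\partial(t)=(x^{n}+z^{e})^{l}$. Then: (1) $\mathrm{ML}(B_{n,e,l,Q})=k[x,z]$. Consequently $B_{n,e,l,Q}$ is semi-rigid. (2) Every $D\in\mathrm{LND}(B_{n,e,l,Q})$ has the form $D=f(x,z)\partial$ with $f(x,z)\in k[x,z]$.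
   Context: For a commutative domain $B$ over a field $k$ of characteristic zero, a $k$-derivation $\partial$ of $B$ is locally nilpotent if for every $a\in B$ there is $N\ge 0$ with $\partial^{N}(a)=0$; $\mathrm{LND}(B)$ is the set of locally nilpotent $k$-derivations of $B$. The Makar-Limanov invariant is $\mathrm{ML}(B)=\bigcap_{D\in\mathrm{LND}(B)}\ker D$. For $\partial\in\mathrm{LND}(B)$, $\deg_\partial(a)=\min\{i\in\mathbb{N}\mid \partial^{i+1}(a)=0\}$ for $a\neq 0$ and $\deg_\partial(0)=-\infty$. $B$ is semi-rigid if all non-zero $\partial\in\mathrm{LND}(B)$ induce the same degree function $\deg_\partial$ (equivalently, the same filtration). *)

(* Defs.v *)
From HB Require Import structures.
From mathcomp Require Import all_boot all_order all_algebra.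
From mathcomp Require Import generic_quotient ring_quotient.
From mathcomp Require Import boolp.
From mathcomp Require Import mpoly ring.

Set Implicit Arguments.
Unset Strict Implicit.
Unset Printing Implicit Defensive.

Import GRing.Theory.
Local Open Scope ring_scope.
Local Open Scope quotient_scope.

Section LND.

Variables (k : fieldType) (B : comAlgType k).

Record LND := MkLND {
  lnd_fun :> {linear B -> B};
  lnd_leibniz : forall a b, lnd_fun (a * b) = lnd_fun a * b + a * lnd_fun b;
  lnd_nilpotent : forall a, exists N, iter N lnd_fun a = 0
}.

Definition ML (b : B) : Prop := forall D : LND, D b = 0.

Fact lnd_deg_subproof (D : LND) a : exists i, iter i.+1 D a == 0.
Proof. by have [N DN] := lnd_nilpotent D a; exists N; rewrite iterS DN raddf0. Qed.

(* [None] stands for -oo, the degree of 0. *)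
Definition lnd_deg (D : LND) (a : B) : option nat :=
  if a == 0 then None else Some (ex_minn (lnd_deg_subproof D a)).

Definition semi_rigid : Prop :=
  forall D E : LND, ~ (D =1 \0) -> ~ (E =1 \0) -> lnd_deg D =1 lnd_deg E.

(* p(u, v), for p a polynomial in two variables; k[u, v] is the set of all
   these elements. *)
Definition eval2 (u v : B) (p : {mpoly k[2]}) : B :=
  mmap (in_alg B) (tnth [tuple u; v]) p.

End LND.

Section PrincipalQuotient.

Variables (k : fieldType) (A : comAlgType k) (g : A).

Definition principal_pred : {pred A} := fun p => `[< exists q, p = q * g >].

Hypothesis g_proper : 1 \notin principal_pred.

(* Carries [g_proper], because the ideals of [ring_quotient] are proper. *)
Definition principal_ideal : {pred A} :=
  let _ := g_proper in principal_pred.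

Lemma principal_idealP p :
  reflect (exists q, p = q * g) (p \in principal_ideal).
Proof. exact: asboolP. Qed.

Fact principal_ideal_closed : idealr_closed principal_ideal.
Proof.
split; first by apply/principal_idealP; exists 0; rewrite mul0r.
- exact: g_proper.
- move=> a u v /principal_idealP[p ->] /principal_idealP[q ->].
  by apply/principal_idealP; exists (a * p + q); rewrite mulrDl mulrA.
Qed.

HB.instance Definition _ :=
  isIdealr.Build A principal_ideal principal_ideal_closed.

Definition principal_quot : Type := {ideal_quot principal_ideal}.

HB.instance Definition _ := GRing.ComNzRing.on principal_quot.

Definition proj (p : A) : principal_quot := \pi_{ideal_quot principal_ideal} p.

Lemma proj_surj b : exists p, b = proj p.
Proof. by exists (repr (b : {ideal_quot principal_ideal})); rewrite /proj reprK. Qed.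

Lemma proj_eq p q : proj p = proj q <-> exists r, p - q = r * g.
Proof.
rewrite /proj; split.
- by move/eqP; rewrite -Quotient.idealrBE => /principal_idealP.
- by move=> h; apply/eqP; rewrite -Quotient.idealrBE; apply/principal_idealP.
Qed.

Fact proj_is_zmod_morphism : zmod_morphism proj.
Proof. by move=> p q; rewrite /proj raddfB. Qed.
HB.instance Definition _ :=
  GRing.isZmodMorphism.Build A principal_quot proj proj_is_zmod_morphism.

Fact proj_is_monoid_morphism : monoid_morphism proj.
Proof. by split=> [|p q]; rewrite /proj ?rmorph1 ?rmorphM. Qed.
HB.instance Definition _ :=
  GRing.isMonoidMorphism.Build A principal_quot proj proj_is_monoid_morphism.

Definition quot_scale (c : k) (b : principal_quot) : principal_quot :=
  proj c%:A * b.

Fact quot_scalerA c d b : quot_scale c (quot_scale d b) = quot_scale (c * d) b.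
Proof.
by rewrite /quot_scale mulrA -rmorphM /= -scalerAl mul1r scalerA.
Qed.
Fact quot_scale1r : left_id 1 quot_scale.
Proof. by move=> b; rewrite /quot_scale scale1r rmorph1 mul1r. Qed.
Fact quot_scalerDr : right_distributive quot_scale +%R.
Proof. by move=> c a b; rewrite /quot_scale mulrDr. Qed.
Fact quot_scalerDl b : {morph quot_scale^~ b : c d / c + d}.
Proof. by move=> c d; rewrite /quot_scale scalerDl raddfD mulrDl. Qed.
HB.instance Definition _ := GRing.Zmodule_isLmodule.Build k principal_quot
  quot_scalerA quot_scale1r quot_scalerDr quot_scalerDl.

Fact quot_scalerAl (c : k) (a b : principal_quot) : c *: (a * b) = (c *: a) * b.
Proof. by rewrite /GRing.scale /= /quot_scale mulrA. Qed.
HB.instance Definition _ :=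
  GRing.Lmodule_isLalgebra.Build k principal_quot quot_scalerAl.
HB.instance Definition _ :=
  GRing.Lalgebra_isComAlgebra.Build k principal_quot.

Fact proj_is_scalable : scalable proj.
Proof.
by move=> c p; rewrite {2}/GRing.scale /= /quot_scale -rmorphM /= mulr_algl.
Qed.
HB.instance Definition _ :=
  GRing.isScalable.Build k A principal_quot *:%R proj proj_is_scalable.

End PrincipalQuotient.

Section Hypersurface.

Variable k : fieldType.

Local Notation P := {mpoly k[4]}.

Definition pX : P := 'X_(inord 0).
Definition pY : P := 'X_(inord 1).
Definition pZ : P := 'X_(inord 2).
Definition pT : P := 'X_(inord 3).

Definition ddT (p : P) : P := p^`M(inord 3).

(* [f i] is the coefficient usually numbered i + 1, i.e. that of pT^(m-i-1). *)
Definition Qpoly (m : nat) (f : 'I_m -> {mpoly k[2]}) : P :=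
  pT ^+ m + \sum_(i < m) eval2 pX pZ (f i) * pT ^+ (m - i.+1).

Definition Bpoly (n e l m : nat) (f : 'I_m -> {mpoly k[2]}) : P :=
  pY * (pX ^+ n + pZ ^+ e) ^+ l - Qpoly f.

(* [Bpoly] is not a unit: (X, Y, Z, T) = (1, Q(1, 0, 0), 0, 0) is a zero. *)
Fact Bpoly_proper n e l m (f : 'I_m -> {mpoly k[2]}) :
  (1 < e)%N -> 1 \notin principal_pred (Bpoly n e l f).
Proof.
move=> e_gt1; apply/negP => /asboolP[q].
pose c := meval (fun i : 'I_4 => (i == inord 0)%:R : k) (Qpoly f).
pose v i : k := if i == inord 1 :> 'I_4 then c else (i == inord 0)%:R.
have neq i j : (i < 4)%N -> (j < 4)%N -> i != j ->
    ((inord i : 'I_4) == inord j) = false.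
  by move=> i4 j4 /negPf ij; rewrite -val_eqE /= !inordK.
have vX : meval v pX = 1 by rewrite /pX mevalXU /v neq // eqxx.
have vZ : meval v pZ = 0 by rewrite /pZ mevalXU /v !neq.
have vT : meval v pT = 0 by rewrite /pT mevalXU /v !neq.
have vY : meval v pY = c by rewrite /pY mevalXU /v eqxx.
have vev (p : {mpoly k[2]}) (w : 'I_4 -> k) : w (inord 0) = 1 -> w (inord 2) = 0 ->
    meval w (eval2 pX pZ p) = meval (tnth [tuple 1; 0]) p.
  move=> w0 w2; rewrite /eval2 /mmap rmorph_sum mevalE /=.
  apply: eq_bigr => i _; rewrite rmorphM /= linearZ /= rmorph1 mulr1.
  congr (_ * _); rewrite /mmap1 rmorph_prod; apply: eq_bigr => j _.
  rewrite rmorphXn /=; congr (_ ^+ _).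
  case: j => -[|[|//]] j2; rewrite !(tnth_nth 0) /=.
    by rewrite /pX mevalXU.
  by rewrite /pZ mevalXU.
have vQ : meval v (Qpoly f) = c.
  rewrite /c /Qpoly !rmorphD !rmorphXn /= vT [in RHS]/pT mevalXU neq //.
  congr (_ + _); rewrite !rmorph_sum; apply: eq_bigr => i _.
  rewrite !rmorphM !rmorphXn /= vT ?mevalXU neq //.
  by rewrite !vev ?eqxx ?neq // /v ?eqxx ?neq // ?eqxx.
have vB : meval v (Bpoly n e l f) = 0.
  rewrite /Bpoly rmorphB rmorphM !rmorphXn rmorphD !rmorphXn /= vX vY vZ vQ.
  by rewrite expr1n expr0n gtn_eqF ?(ltnW e_gt1) //= addr0 expr1n mulr1 subrr.
move/(congr1 (meval v)); rewrite rmorphM /= vB mulr0 rmorph1.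
by move/eqP; rewrite oner_eq0.
Qed.

Definition Balg (n e l m : nat) (e_gt1 : (1 < e)%N)
    (f : 'I_m -> {mpoly k[2]}) : comAlgType k :=
  principal_quot (Bpoly_proper n l f e_gt1).

Definition Bproj (n e l m : nat) (e_gt1 : (1 < e)%N)
    (f : 'I_m -> {mpoly k[2]}) : {lrmorphism P -> Balg n l e_gt1 f} :=
  @proj k P _ (Bpoly_proper n l f e_gt1).

Section Derivation.

Variables (n e l m : nat) (e_gt1 : (1 < e)%N) (f : 'I_m -> {mpoly k[2]}).

Local Notation B := (Balg n l e_gt1 f).
Local Notation pi := (Bproj n l e_gt1 f).
Local Notation Q := (Qpoly f).
Local Notation wl := ((pX ^+ n + pZ ^+ e) ^+ l).

(* Kills [Bpoly], hence descends to the quotient. *)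
Definition lift_der (p : P) : P := ddT Q * p^`M(inord 1) + wl * p^`M(inord 3).

Fact lift_der_is_linear : linear lift_der.
Proof.
move=> c p q; rewrite /lift_der !linearP /= !mulrDr scalerDr -!scalerAr.
by rewrite addrACA.
Qed.
HB.instance Definition _ :=
  GRing.isLinear.Build k P P *:%R lift_der lift_der_is_linear.

Lemma lift_derM p q : lift_der (p * q) = lift_der p * q + p * lift_der q.
Proof.
by rewrite /lift_der !mderivM; ring.
Qed.

Let neq i j : (i < 4)%N -> (j < 4)%N -> i != j ->
  ((inord i : 'I_4) == inord j) = false.
Proof. by move=> i4 j4 /negPf ij; rewrite -val_eqE /= !inordK. Qed.

Let derV i j : ('X_i : P)^`M(j) = (i == j)%:R.
Proof.
rewrite mderivX mnmE; case: eqVneq => [->|_]; last by rewrite scale0r.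
by rewrite scale1r (_ : (U_(j) - U_(j))%MM = 0%MM) ?mpolyX0 //; apply/mnmP => h; rewrite mnmBE subnn mnm0E.
Qed.

Let derX (i : 'I_4) (p : P) t : p^`M(i) = 0 -> (p ^+ t)^`M(i) = 0.
Proof.
move=> p0; elim: t => [|t IH]; first by rewrite expr0 -mpolyC1 mderivC.
by rewrite exprS mderivM p0 IH mul0r mulr0 addr0.
Qed.

Let der_eval2 (p : {mpoly k[2]}) (i : 'I_4) :
  i != inord 0 -> i != inord 2 -> (eval2 pX pZ p)^`M(i) = 0.
Proof.
move=> i0 i2; have pX0 : pX^`M(i) = 0 by rewrite derV eq_sym (negPf i0).
have pZ0 : pZ^`M(i) = 0 by rewrite derV eq_sym (negPf i2).
rewrite /eval2 /mmap raddf_sum big1 // => j _.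
rewrite /= mulr_algl mderivZ; suff -> : (mmap1 (tnth [tuple pX; pZ]) j)^`M(i) = 0.
  by rewrite scaler0.
rewrite /mmap1; apply: (big_ind (fun q : P => q^`M(i) = 0)).
- by rewrite -mpolyC1 mderivC.
- by move=> a b a0 b0; rewrite mderivM a0 b0 mul0r mulr0 addr0.
- move=> t _; apply: derX; case: t => -[|[|//]] t2;
  by rewrite (tnth_nth 0).
Qed.

Let der_wl (i : 'I_4) : i != inord 0 -> i != inord 2 -> wl^`M(i) = 0.
Proof.
move=> i0 i2; apply: derX; rewrite mderivD !derX ?addr0 //.
  by rewrite derV eq_sym (negPf i2).
by rewrite derV eq_sym (negPf i0).
Qed.

Let derQ_Y : Q^`M(inord 1) = 0.
Proof.
have T0 t : (pT ^+ t)^`M(inord 1) = 0 by apply: derX; rewrite derV neq.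
rewrite mderivD T0 add0r raddf_sum big1 //= => i _.
by rewrite mderivM T0 der_eval2 ?neq // mul0r mulr0 addr0.
Qed.

Lemma lift_der_Bpoly : lift_der (Bpoly n e l f) = 0.
Proof.
rewrite /lift_der /Bpoly !mderivB !mderivM !der_wl ?neq //.
by rewrite derQ_Y !derV eqxx neq //= !mul0r !mulr0 !addr0 subr0 sub0r
  mul1r mulrN mulrC subrr.
Qed.

Definition quot_der (b : B) : B := pi (lift_der (repr b)).

Lemma quot_derE p : quot_der (pi p) = pi (lift_der p).
Proof.
rewrite /quot_der; apply/proj_eq.
have /proj_eq[r Er] : pi (repr (pi p)) = pi p by rewrite /= /proj reprK.
exists (lift_der r); rewrite -raddfB /= Er lift_derM lift_der_Bpoly.
by rewrite mulr0 addr0.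
Qed.

Fact quot_der_is_linear : linear quot_der.
Proof.
move=> c a b; have [p ->] := proj_surj a; have [q ->] := proj_surj b.
by rewrite -[proj _ p]/(pi p) -[proj _ q]/(pi q) -linearP /= !quot_derE !linearP.
Qed.
HB.instance Definition _ :=
  GRing.isLinear.Build k B B *:%R quot_der quot_der_is_linear.

Lemma quot_derM a b : quot_der (a * b) = quot_der a * b + a * quot_der b.
Proof.
have [p ->] := proj_surj a; have [q ->] := proj_surj b.
rewrite -[proj _ p]/(pi p) -[proj _ q]/(pi q) -rmorphM /= !quot_derE.
by rewrite lift_derM rmorphD !rmorphM.
Qed.

Let nil (p : P) := exists N, iter N lift_der p = 0.

Let iter0 N M p : (N <= M)%N -> iter N lift_der p = 0 -> iter M lift_der p = 0.
Proof.
move=> /subnK <- p0; rewrite iterD p0; elim: (M - N)%N => //= j ->.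
exact: raddf0.
Qed.

Let iterDD N p q : iter N lift_der (p + q) = iter N lift_der p + iter N lift_der q.
Proof. by elim: N => //= N ->; rewrite raddfD. Qed.

Let nilD p q : nil p -> nil q -> nil (p + q).
Proof.
move=> [N pN] [M qM]; exists (N + M)%N.
by rewrite iterDD (iter0 _ pN) ?leq_addr // (iter0 _ qM) ?leq_addl // addr0.
Qed.

Let nilM p q : nil p -> nil q -> nil (p * q).
Proof.
move=> [N pN] [M qM]; exists (N + M)%N.
have it0 j : iter j lift_der 0 = 0 by elim: j => //= j ->; exact: raddf0.
elim: N M p q pN qM => [|N IHN] M p q; first by move=> /= -> _; rewrite mul0r it0.
elim: M p q => [|M IHM] p q pN qM; first by rewrite [q]qM mulr0 it0.
rewrite addSn iterSr lift_derM iterDD IHN ?add0r -?iterSr // addnS -addSn.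
by rewrite IHM // -iterSr.
Qed.

Let nil_ker p : lift_der p = 0 -> nil p.
Proof. by exists 1%N. Qed.

Let nil_step p : nil (lift_der p) -> nil p.
Proof. by case=> N pN; exists N.+1; rewrite iterSr. Qed.

Let nilC c : nil c%:MP.
Proof. by apply: nil_ker; rewrite /lift_der !mderivC !mulr0 addr0. Qed.

Let nilT : nil pT.
Proof.
apply: nil_step; rewrite /lift_der !derV eqxx neq //= mulr0 mulr1 add0r.
by apply: nil_ker; rewrite /lift_der !der_wl ?neq // !mulr0 addr0.
Qed.

Let nil_ker2 p : p^`M(inord 1) = 0 -> p^`M(inord 3) = 0 -> nil p.
Proof. by move=> p1 p3; apply: nil_ker; rewrite /lift_der p1 p3 !mulr0 addr0. Qed.

Let nilX p t : nil p -> nil (p ^+ t).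
Proof.
move=> np; elim: t => [|t IH]; first by rewrite expr0 -mpolyC1.
by rewrite exprS; apply: nilM.
Qed.

Let nil_sum (I : Type) (r : seq I) (F : I -> P) :
  (forall i, nil (F i)) -> nil (\sum_(i <- r) F i).
Proof.
move=> nF; apply: (big_ind nil) => //; first by rewrite -mpolyC0.
Qed.

Let nil_dT t : nil (pT ^+ t)^`M(inord 3).
Proof.
elim: t => [|t IH]; first by rewrite expr0 -mpolyC1 mderivC -mpolyC0.
rewrite exprS mderivM derV eqxx mul1r.
by apply: nilD; [exact: nilX | exact: nilM].
Qed.

Let nil_ddTQ : nil (ddT Q).
Proof.
rewrite /ddT mderivD; apply: nilD => //; rewrite raddf_sum /=.
apply: nil_sum => i; rewrite mderivM der_eval2 ?neq // mul0r add0r.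
by apply: nilM => //; apply: nil_ker2; rewrite der_eval2 ?neq.
Qed.

Let nilP p : nil p.
Proof.
rewrite [p]mpolyE; apply: nil_sum => mm; rewrite -mul_mpolyC.
apply: nilM => //; rewrite mpolyXE_id.
apply: (big_ind nil) => [|a b|i _]; [by rewrite -mpolyC1| exact: nilM|].
apply: nilX; case: (eqVneq i (inord 3)) => [->|i3] //.
case: (eqVneq i (inord 1)) => [->|i1]; last first.
  by apply: nil_ker2; rewrite derV ?(negPf i1) ?(negPf i3).
apply: nil_step; rewrite /lift_der !derV eqxx neq //=.
by rewrite mulr1 mulr0 addr0.
Qed.

Fact quot_der_nilpotent b : exists N, iter N quot_der b = 0.
Proof.
have [p ->] := proj_surj b; have [N pN] := nilP p; exists N.
have -> : iter N quot_der (pi p) = pi (iter N lift_der p).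
  by elim: (N) => //= j ->; rewrite quot_derE.
by rewrite pN raddf0.
Qed.

Lemma std_lnd_exists : exists d : LND B,
  [/\ d (pi pX) = 0, d (pi pZ) = 0,
      d (pi pY) = pi (ddT Q) & d (pi pT) = (pi pX ^+ n + pi pZ ^+ e) ^+ l].
Proof.
exists (MkLND (lnd_fun := quot_der) quot_derM quot_der_nilpotent).
split; rewrite /= quot_derE /lift_der !derV ?eqxx ?neq //= ?mulr0 ?mulr1 ?addr0
  ?add0r ?rmorph0 //.
by rewrite rmorphXn rmorphD !rmorphXn.
Qed.

End Derivation.

End Hypersurface.

(* Main.v *)
From HB Require Import structures.
Require Import Defs.
From mathcomp Require Import all_boot all_order all_algebra.
From mathcomp Require Import fraction generic_quotient boolp.
From mathcomp Require Import mpoly ring zify.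

Set Implicit Arguments.
Unset Strict Implicit.
Unset Printing Implicit Defensive.

Import GRing.Theory.
Local Open Scope ring_scope.

(* Write w = x^n + z^e and F = k(x, z). Then B embeds in F[t], with y mapped to
   w^-l Q(x, z, t), and B is the free k[x, z]-module on the monomials y^a t^b
   with b < m, whose degrees m a + b in t are pairwise distinct.

   Let D be a locally nilpotent derivation of B that does not kill both x and
   z. If q is its degree with respect to the degree in t, then q >= 0 and the
   top homogeneous part of D is a non-zero derivation delta of F[t], nilpotent
   at x, z, t and Y = w^-l t^m. As q >= 0, Y divides delta(Y), with a quotient
   at which delta is nilpotent, so delta(Y) = 0. If q is not -1 modulo m, then
   t likewise divides delta(t), hence delta(t) = 0 and delta(w) = 0 by
   t^m = Y w^l; otherwise t^(m-1) divides delta(w), and differentiating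
   t^m = Y w^l shows that w divides delta(t), so that delta(w) = 0 again because
   delta lowers degrees. Since n, e >= 2, delta(x^n + z^e) = 0 forces
   delta(x) = delta(z) = 0, then delta(t) = 0, a contradiction.

   So D is determined by D(t), which has degree 0 in t by nilpotency, that is
   D(t) = p(x, z); the coefficient of t^(m-1) in D(y) is m p / w^l, whence w^l
   divides p and D is a multiple of the given derivation. *)

Local Notation tofrac := (@FracField.tofrac _).

(** * Derivations and fraction fields *)

(** [L] is viewed as an [A]-module through [j]: the identity gives derivations of a ring, [polyC]
    those from coefficients into polynomials. *)
Definition derivation_along (A L : nzRingType) (j d : A -> L) :=
  (forall u v, d (u + v) = d u + d v) /\
  (forall u v, d (u * v) = d u * j v + j u * d v).

Section DerivationAlong.

Variables (A L : comNzRingType) (j : {rmorphism A -> L}) (d : A -> L).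
Hypothesis d_der : derivation_along j d.

Lemma der_along0 : d 0 = 0.
Proof. by apply: (addrI (d 0)); rewrite -d_der.1 !addr0. Qed.

Lemma der_along1 : d 1 = 0.
Proof.
by apply: (addrI (d 1)); rewrite addr0 -{3}[1]mulr1 d_der.2 rmorph1 mulr1 mul1r.
Qed.

Lemma der_alongX u i : d (u ^+ i) = (j u ^+ i.-1 * d u) *+ i.
Proof.
case: i => [|i]; first by rewrite expr0 mulr0n der_along1.
elim: i => [|i IH]; first by rewrite !expr1 mul1r.
rewrite exprS d_der.2 IH rmorphXn [in RHS]mulrS; congr (_ + _).
  by rewrite mulrC.
by rewrite mulrnAr mulrA -exprS.
Qed.

Lemma der_along_sum (I : Type) (r : seq I) (E : I -> A) :
  d (\sum_(i <- r) E i) = \sum_(i <- r) d (E i).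
Proof. exact: (big_morph d d_der.1 der_along0). Qed.

End DerivationAlong.

Section Fraction.

Variables (A L : idomainType) (j : {rmorphism {fraction A} -> L}) (d0 : A -> L).
Hypothesis d0_der : derivation_along (fun a => j (tofrac a)) d0.

Lemma frac_repr (u : {fraction A}) :
  exists a b : A, b != 0 /\ u * tofrac b = tofrac a.
Proof.
elim/quotW: u => r; exists (\n_r), (\d_r); split; first exact: denom_ratioP.
unlock FracField.tofrac; rewrite -[LHS]FracField.pi_mul; apply/eqP.
rewrite FracField.equivf_def /FracField.equivf /FracField.mulf /=.
by rewrite !numden_Ratio ?mulr1 ?oner_eq0 ?denom_ratioP // mulrC.
Qed.

(** Quotient rule. The value at [u] is characterised by j(b) d(u) = d0(a) - j(u) d0(b) for every
    representation u b = a, so sums and products are checked by clearing denominators. *)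
Lemma derivation_frac : exists d : {fraction A} -> L,
  (forall a, d (tofrac a) = d0 a) /\ derivation_along j d.
Proof.
have key (u : {fraction A}) : exists v, forall a b, u * tofrac b = tofrac a ->
    j (tofrac b) * v = d0 a - j u * d0 b.
  have [a0 [b0 [b0N0 ub0]]] := frac_repr u.
  have b0N : tofrac b0 != 0 by rewrite tofrac_eq0.
  have jb0N : j (tofrac b0) != 0 by rewrite fmorph_eq0.
  exists (j (tofrac b0)^-1 * (d0 a0 - j u * d0 b0)) => a b ub.
  have E : a * b0 = b * a0.
    apply/eqP; rewrite -tofrac_eq !rmorphM /= -ub -ub0; apply/eqP; ring.
  have := congr1 d0 E; rewrite !d0_der.2 => dE.
  apply: (mulfI jb0N).
  have -> : j (tofrac b0) *
      (j (tofrac b) * (j (tofrac b0)^-1 * (d0 a0 - j u * d0 b0)))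
     = j (tofrac b) * d0 a0 - j (u * tofrac b) * d0 b0.
    rewrite rmorphM; have jV : j (tofrac b0) * j (tofrac b0)^-1 = 1.
      by rewrite -rmorphM divff // rmorph1.
    move: (j _^-1) jV => c jV.
    by rewrite mulrCA [j _ * (c * _)]mulrA jV mul1r; ring.
  rewrite ub; have -> : j (tofrac b0) * (d0 a - j u * d0 b) =
    d0 a * j (tofrac b0) - j (u * tofrac b0) * d0 b by rewrite rmorphM; ring.
  rewrite ub0; apply/eqP; rewrite -subr_eq0; apply/eqP.
  transitivity (- (d0 a * j (tofrac b0) + j (tofrac a) * d0 b0 -
    (d0 b * j (tofrac a0) + j (tofrac b) * d0 a0))); first by ring.
  by rewrite dE subrr oppr0.
have [d dP] := boolp.choice key.
exists d; split=> [a|].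
  have := dP (tofrac a) a 1; rewrite rmorph1 mulr1 => /(_ erefl).
  by rewrite rmorph1 mul1r (der_along1 (j := j \o tofrac)) ?mulr0 ?subr0.
split=> u v.
  have [a [b [bN ub]]] := frac_repr u; have [a' [b' [b'N ub']]] := frac_repr v.
  have jN : j (tofrac (b * b')) != 0 by rewrite fmorph_eq0 tofrac_eq0 mulf_neq0.
  apply: (mulfI jN).
  rewrite (dP _ (a * b' + a' * b)); last first.
    by rewrite rmorphD !rmorphM /= -ub -ub'; ring.
  rewrite d0_der.1 !d0_der.2 -ub -ub' !(rmorphM, rmorphD) /=.
  transitivity (j (tofrac b') * (j (tofrac b) * d u) +
      j (tofrac b) * (j (tofrac b') * d v));
    last by ring.
  by rewrite (dP _ _ _ ub) (dP _ _ _ ub') ; ring.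
have [a [b [bN ub]]] := frac_repr u; have [a' [b' [b'N ub']]] := frac_repr v.
have jN : j (tofrac (b * b')) != 0 by rewrite fmorph_eq0 tofrac_eq0 mulf_neq0.
apply: (mulfI jN).
rewrite (dP _ (a * a')); last by rewrite !rmorphM /= -ub -ub'; ring.
rewrite !d0_der.2 -ub -ub' !rmorphM /=.
transitivity (j v * j (tofrac b') * (j (tofrac b) * d u) +
    j u * j (tofrac b) * (j (tofrac b') * d v));
    last by ring.
by rewrite (dP _ _ _ ub) (dP _ _ _ ub') ; ring.
Qed.

End Fraction.

(** * Locally nilpotent elements of a derivation *)

Section Exponential.

Variables (R : idomainType) (delta : R -> R).
Hypothesis R_char0 : forall i, (i.+1%:R : R) != 0.
Hypothesis delta_der : derivation_along idfun delta.

Local Notation K := {fraction R}.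
Implicit Types (u v : R) (p q : {poly K}).

Definition nilpotent_at u := exists N, iter N delta u = 0.

(* [p] is exp(T * delta)(u), with denominators cleared coefficientwise. *)
Definition is_exp u p := forall i, p`_i *+ i`! = tofrac (iter i delta u).

Let iter_der0 i : iter i delta 0 = 0.
Proof. by elim: i => //= i ->; exact: der_along0 delta_der. Qed.

Let K_char0 i : (i.+1%:R : K) != 0.
Proof. by rewrite -(rmorph_nat (@FracField.tofrac R)) tofrac_eq0. Qed.

Let mulrn_inj i (a b : K) : (0 < i)%N -> a *+ i = b *+ i -> a = b.
Proof.
case: i => // i _; rewrite -[a *+ _]mulr_natr -[b *+ _]mulr_natr.
exact: mulIf (K_char0 i) _ _.
Qed.

Let poly_char0 i p : (0 < i)%N -> (p *+ i == 0) = (p == 0).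
Proof.
move=> i_gt0; apply/eqP/eqP => [p0|->]; last by rewrite mul0rn.
apply/polyP => j; apply: (mulrn_inj i_gt0).
by rewrite -coefMn p0 coef0 mul0rn.
Qed.

Lemma is_exp_uniq u p q : is_exp u p -> is_exp u q -> p = q.
Proof.
move=> up uq; apply/polyP => i; apply: (@mulrn_inj i`!); first exact: fact_gt0.
by rewrite up uq.
Qed.

Lemma is_exp_deriv u p : is_exp u p -> is_exp (delta u) p^`().
Proof.
by move=> up i; rewrite coef_deriv -mulrnA -factS up -iterSr.
Qed.

(** The constant coefficient of [p] is [u]. *)
Lemma is_exp_inj u p : is_exp u p -> (p == 0) = (u == 0).
Proof.
move=> up; apply/eqP/eqP => [p0|u0].
  by have /eqP := up 0%N; rewrite p0 coef0 mul0rn eq_sym tofrac_eq0 => /eqP.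
apply: (is_exp_uniq up) => i; rewrite coef0 mul0rn u0.
by rewrite iter_der0 rmorph0.
Qed.

Lemma is_exp_nilpotent u : nilpotent_at u -> exists p, is_exp u p.
Proof.
move=> [N uN]; exists (\poly_(i < N) (tofrac (iter i delta u) / i`!%:R)) => i.
rewrite coef_poly; case: ltnP => iN.
  rewrite -[LHS]mulr_natr divfK //; have := fact_gt0 i.
  by case: (i`!) => // j _; exact: K_char0.
have -> : iter i delta u = 0.
  by rewrite -(subnK iN) iterD uN iter_der0.
by rewrite rmorph0 mul0rn.
Qed.

Lemma is_expD u v p q : is_exp u p -> is_exp v q -> is_exp (u + v) (p + q).
Proof.
move=> up vq i; rewrite coefD mulrnDl up vq -rmorphD /=; congr tofrac.
by elim: i => //= i <-; rewrite delta_der.1.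
Qed.

(** The binomial formula is avoided by induction on the coefficient: the derivative p' q + p q'
    corresponds to delta(u) v + u delta(v). *)
Lemma is_expM u v p q : is_exp u p -> is_exp v q -> is_exp (u * v) (p * q).
Proof.
move=> up vq i; elim: i u v p q up vq => [|i IH] u v p q up vq.
  have := up 0%N; have := vq 0%N; rewrite /= !mulr1n => v0 u0.
  by rewrite coef0M v0 u0 rmorphM.
rewrite factS mulrnA -coef_deriv derivM coefD mulrnDl.
rewrite (IH _ _ _ _ (is_exp_deriv up) vq) (IH _ _ _ _ up (is_exp_deriv vq)).
rewrite -rmorphD iterSr delta_der.2 /=; congr tofrac.
by elim: (i) => //= j <-; rewrite delta_der.1.
Qed.

Lemma is_exp_const u : delta u = 0 -> is_exp u (tofrac u)%:P.
Proof.
move=> u0 [|i]; first by rewrite coefC.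
by rewrite coefC mul0rn iterSr u0 iter_der0 rmorph0.
Qed.

Lemma is_expX u p i : is_exp u p -> is_exp (u ^+ i) (p ^+ i).
Proof.
move=> up; elim: i => [|i IH]; last by rewrite !exprS; apply: is_expM.
rewrite !expr0 -[X in is_exp _ X]polyC1 -(rmorph1 (@FracField.tofrac R)).
exact/is_exp_const/(der_along1 delta_der).
Qed.

(** On exponentials the equation becomes p' = p q, impossible by degrees unless p' = 0. *)
Lemma derivation_dvd u v :
  nilpotent_at u -> nilpotent_at v -> delta u = u * v -> delta u = 0.
Proof.
move=> /is_exp_nilpotent[p up] /is_exp_nilpotent[q vq] duv.
have pE : p^`() = p * q.
  by apply: is_exp_uniq (is_exp_deriv up) _; rewrite duv; exact: is_expM.
apply/eqP; rewrite -(is_exp_inj (is_exp_deriv up)).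
apply: contraT => p'N; have pN : p != 0 by apply: contraNneq p'N => ->; rewrite deriv0.
have := dvdp_leq p'N; rewrite pE => /(_ p (dvdp_mulr _ (dvdpp p))).
by rewrite -pE leqNgt lt_size_deriv.
Qed.

(** As n >= 2, [p] divides the first term, hence also q' q^(e-1), and it is coprime to q^(e-1). *)
Let dvd_deriv p q n e : (1 < n)%N -> (1 < e)%N -> coprimep p q ->
  p^`() * p ^+ n.-1 *+ n + q^`() * q ^+ e.-1 *+ e = 0 -> p %| q^`().
Proof.
case: n => [|[|n]] // _; case: e => [|e] // _ co /eqP; rewrite addrC addr_eq0 => /eqP dE.
rewrite -(Gauss_dvdpl _ (coprimep_expr e co)) -(dvdpZr _ _ (K_char0 e)).
rewrite scaler_nat dE -mulNrn exprS -scaler_nat (dvdpZr _ _ (K_char0 _)).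
by rewrite -mulNr mulrCA dvdp_mulr.
Qed.

(** Otherwise q' is non-zero too, and p | q', q | p' give deg p < deg q < deg p. *)
Let deriv_eq0 p q n e : (1 < n)%N -> (1 < e)%N -> coprimep p q ->
  p^`() * p ^+ n.-1 *+ n + q^`() * q ^+ e.-1 *+ e = 0 -> p^`() = 0.
Proof.
move=> n_gt1 e_gt1 co dE; apply/eqP; apply: contraT => p'N.
have pN : p != 0 by apply: contraNneq p'N => ->; rewrite deriv0.
have q'N : q^`() != 0.
  apply: contraNneq p'N => q'0; move: dE; rewrite q'0 mul0r mul0rn addr0 => /eqP.
  by rewrite poly_char0 ?(ltnW n_gt1) // mulf_eq0 expf_eq0 (negPf pN) andbF orbF.
have qN : q != 0 by apply: contraNneq q'N => ->; rewrite deriv0.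
have pq := dvd_deriv n_gt1 e_gt1 co dE.
have qp : q %| p^`().
  by apply: (dvd_deriv e_gt1 n_gt1); rewrite 1?coprimep_sym // addrC.
have := leq_ltn_trans (dvdp_leq q'N pq) (lt_size_deriv qN).
by rewrite ltnNge ltnW // (leq_ltn_trans (dvdp_leq p'N qp)) // lt_size_deriv.
Qed.

(* If [delta] did not kill both [u] and [v], their exponentials [p] and [q]
   would be coprime non-constant polynomials with [p] dividing [q'] and [q]
   dividing [p']. *)
Lemma derivation_power_sum u v n e :
  (1 < n)%N -> (1 < e)%N -> nilpotent_at u -> nilpotent_at v ->
  u ^+ n + v ^+ e != 0 -> delta (u ^+ n + v ^+ e) = 0 ->
  delta u = 0 /\ delta v = 0.
Proof.
move=> n_gt1 e_gt1 /is_exp_nilpotent[p up] /is_exp_nilpotent[q vq] wN w0.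
have pqE : p ^+ n + q ^+ e = (tofrac (u ^+ n + v ^+ e))%:P.
  apply: is_exp_uniq (is_exp_const w0).
  by apply: is_expD; apply: is_expX.
(* [p ^+ n + q ^+ e] is a non-zero constant, and its inverse provides the Bezout coefficients. *)
have co : coprimep p q.
  have : coprimep (p ^+ n) (q ^+ e).
    apply/Bezout_eq1_coprimepP; exists ((tofrac (u ^+ n + v ^+ e))^-1%:P,
      (tofrac (u ^+ n + v ^+ e))^-1%:P) => /=.
    by rewrite -mulrDr pqE -polyCM mulVf // tofrac_eq0.
  by rewrite coprimep_pexpl ?coprimep_pexpr // ltnW.
have dE : p^`() * p ^+ n.-1 *+ n + q^`() * q ^+ e.-1 *+ e = 0.
  by rewrite -!deriv_exp -derivD pqE derivC.
split; apply/eqP.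
  by rewrite -(is_exp_inj (is_exp_deriv up)) (deriv_eq0 n_gt1 e_gt1 co dE).
rewrite -(is_exp_inj (is_exp_deriv vq)) (deriv_eq0 e_gt1 n_gt1 (p := q) (q := p)) //.
  by rewrite coprimep_sym.
by rewrite addrC.
Qed.

(* The exponential of [s] divides that of [delta w], so has a smaller degree
   than that of [w]; differentiating [s ^+ m = y * w ^+ l] shows the converse. *)
Lemma derivation_modification w s y g m l j :
  (1 < m)%N -> (1 < l)%N ->
  nilpotent_at w -> nilpotent_at s -> nilpotent_at y -> nilpotent_at g ->
  s != 0 -> s ^+ m = y * w ^+ l -> delta y = 0 ->
  delta w = g * y ^+ j * s ^+ m.-1 -> delta w = 0.
Proof.
case: m => [|[|m]] // _; case: l => [|[|l]] // _.
move=> /is_exp_nilpotent[pw wP] /is_exp_nilpotent[ps sP].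
move=> /is_exp_nilpotent[py yP] /is_exp_nilpotent[pg gP] sN sE dy dw.
apply/eqP; rewrite -(is_exp_inj (is_exp_deriv wP)); apply: contraT => w'N.
have psN : ps != 0 by rewrite (is_exp_inj sP).
have pwN : pw != 0 by apply: contraNneq w'N => ->; rewrite deriv0.
have w'E : pw^`() = pg * py ^+ j * ps ^+ m.+1.
  apply: is_exp_uniq (is_exp_deriv wP) _; rewrite dw.
  by repeat apply: is_expM => //; apply: is_expX.
have y'0 : py^`() = 0.
  by apply/eqP; rewrite (is_exp_inj (is_exp_deriv yP)) dy.
have psE : ps ^+ m.+2 = py * pw ^+ l.+2.
  by apply: is_exp_uniq (is_expX _ sP) _; rewrite sE; apply: is_expM => //; apply: is_expX.
have pyN : py != 0.
  by apply: contraNneq psN => y0; move/eqP: psE; rewrite y0 mul0r expf_eq0 => /andP[].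
(* Differentiate [psE], where [py] is constant, substitute [w'E] and cancel [ps ^+ m.+1]. *)
have s'E : ps^`() *+ m.+2 = pg * py ^+ j.+1 * pw ^+ l.+1 *+ l.+2.
  apply: (mulIf (expf_neq0 m.+1 psN)).
  have := congr1 (@deriv _) psE; rewrite derivM y'0 mul0r add0r !deriv_exp /=.
  rewrite mulrnAl => ->; rewrite w'E mulrnAr !mulrnAl; congr (_ *+ _).
  by rewrite [py ^+ j.+1]exprS; ring.
have w's : ps %| pw^`() by rewrite w'E dvdp_mull // exprS dvdp_mulr.
have s'N : ps^`() != 0.
  rewrite -(poly_char0 _ (isT : 0 < m.+2)%N) s'E poly_char0 //.
  rewrite !mulf_neq0 ?expf_neq0 //.
  by apply: contraNneq w'N => g0; rewrite w'E g0 !mul0r.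
have s'w : pw %| ps^`().
  rewrite -(dvdpZr _ _ (K_char0 m.+1)) scaler_nat s'E -mulrnAl.
  by rewrite dvdp_mull // exprS dvdp_mulr.
have := leq_ltn_trans (dvdp_leq s'N s'w) (lt_size_deriv psN).
by rewrite ltnNge ltnW // (leq_ltn_trans (dvdp_leq w'N w's)) // lt_size_deriv.
Qed.

End Exponential.

(** * Top homogeneous part of a derivation of a polynomial ring *)

Section PolyDerivation.

Variables (F : idomainType).

(** The derivation of F[X] that extends [d] on coefficients and takes the value [v] at 'X. *)
Definition polyder (d : F -> {poly F}) (v p : {poly F}) : {poly F} :=
  \sum_(i < size p) d p`_i * 'X^i + p^`() * v.

Variables (d : F -> {poly F}) (v : {poly F}).
Hypothesis d_der : derivation_along polyC d.

Local Notation D := (polyder d v).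
Implicit Types p r : {poly F}.

Let d0 : d 0 = 0.
Proof. exact: (der_along0 (j := polyC) d_der). Qed.

(** Since d(0) = 0, polynomials of different sizes can be summed over a common range. *)
Let polyder_bound N p : (size p <= N)%N ->
  D p = \sum_(i < N) d p`_i * 'X^i + p^`() * v.
Proof.
move=> pN; congr (_ + _).
rewrite (big_ord_widen_cond _ xpredT (fun i => d p`_i * 'X^i) pN).
rewrite big_mkcond /=; apply: eq_bigr => i _; case: ltnP => // pi.
by rewrite nth_default // d0 mul0r.
Qed.

Let polyderD p r : D (p + r) = D p + D r.
Proof.
have [pN rN] := (leq_maxl (size p) (size r), leq_maxr (size p) (size r)).
rewrite (polyder_bound pN) (polyder_bound rN).
rewrite (polyder_bound (leq_trans (size_polyD _ _) (leqnn _))) derivD mulrDl addrACA.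
congr (_ + _); rewrite -big_split /=; apply: eq_bigr => i _.
by rewrite coefD d_der.1 mulrDl.
Qed.

Lemma polyderC c : D c%:P = d c.
Proof.
rewrite (polyder_bound (size_polyC_leq1 _)) big_ord1 coefC eqxx expr0 mulr1.
by rewrite derivC mul0r addr0.
Qed.

Let polyderCM c p : D (c%:P * p) = d c * p + c%:P * D p.
Proof.
have cpN : (size (c%:P * p)%R <= size p)%N.
  by rewrite mul_polyC size_scale_leq.
rewrite (polyder_bound cpN) /polyder derivM derivC mul0r add0r.
have pE : d c * p = \sum_(i < size p) d c * ((p`_i)%:P * 'X^i).
  rewrite -mulr_sumr; congr (_ * _); rewrite -[LHS]coefK poly_def.
  by apply: eq_bigr => i _; rewrite mul_polyC.
rewrite pE mulrDr mulr_sumr addrA -big_split /= mulrA; congr (_ + _).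
apply: eq_bigr => i _; rewrite coefCM d_der.2; ring.
Qed.

Let polyderMX p : D (p * 'X) = D p * 'X + p * v.
Proof.
have pN : (size (p * 'X)%R <= (size p).+1)%N.
  by rewrite (leq_trans (size_polyMleq _ _)) // size_polyX addn2.
rewrite (polyder_bound pN) big_ord_recl coefMX eqxx d0 mul0r add0r.
rewrite derivM derivX mulr1 !mulrDl !addrA mulr_suml; congr (_ + _).
congr (_ + _); last by rewrite mulrAC.
by apply: eq_bigr => i _; rewrite coefMX /= -mulrA -exprSr.
Qed.

(** Horner induction on the first factor reduces the Leibniz rule to products with a constant and
    with 'X. *)
Lemma polyder_der : derivation_along idfun D.
Proof.
split=> // p r /=; elim/poly_ind: p => [|p c IH].
  by rewrite !mul0r -[0]polyC0 polyderC d0 mul0r addr0.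
rewrite mulrDl -mulrA ['X * r]mulrC mulrA !polyderD polyderMX IH polyderCM.
by rewrite polyderMX polyderC; ring.
Qed.

Lemma polyderX : D 'X = v.
Proof.
rewrite -[X in D X]mul1r polyderMX -[1]polyC1 polyderC.
by rewrite (der_along1 (j := polyC) d_der) mul0r add0r polyC1 mul1r.
Qed.

Lemma polyder_monomial u (i : nat) :
  D (u *: 'X^i) = d u * 'X^i + (u *: ('X^(i.-1) * v)) *+ i.
Proof.
rewrite -mul_polyC polyderCM (der_alongX (j := idfun) polyder_der) polyderX /=.
by rewrite mulrnAr mul_polyC.
Qed.

End PolyDerivation.

Section Homogenization.

Variables (F : idomainType) (d : F -> {poly F}) (v : {poly F}) (q : nat).
Hypothesis d_der : derivation_along polyC d.
Hypothesis size_d : forall u, (size (d u) <= q.+1)%N.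
Hypothesis size_v : (size v <= q.+2)%N.

(** The homogeneous component of degree [i]. It is used with [i] a mere upper bound for the degree,
    so it may vanish. *)
Definition top_part i (p : {poly F}) : {poly F} := p`_i *: 'X^i.

(** The component of degree [q] of the derivation: elements of F have degree 0 and 'X has degree 1,
    hence the indices [q] and [q.+1]. *)
Definition top_der : {poly F} -> {poly F} :=
  polyder (fun u => top_part q (d u)) (top_part q.+1 v).

Local Notation D := (polyder d v).
Implicit Types p r : {poly F}.

Let top_d_der : derivation_along polyC (fun u => top_part q (d u)).
Proof.
split=> a b; rewrite /top_part; first by rewrite d_der.1 coefD scalerDl.
rewrite d_der.2 coefD coefMC coefCM scalerDl -!mul_polyC !polyCM; ring.
Qed.

Lemma top_der_der : derivation_along idfun top_der.
Proof. exact: polyder_der. Qed.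

Let size_D_monomial u i : (size (D (u *: 'X^i)%R) <= (i + q).+1)%N.
Proof.
rewrite polyder_monomial //; apply/(leq_trans (size_polyD _ _)); rewrite geq_max.
apply/andP; split.
  rewrite (leq_trans (size_polyMleq _ _)) // size_polyXn addnS /= addnC.
  by rewrite -addnS leq_add2l.
case: i => [|i]; first by rewrite mulr0n size_poly0.
rewrite -scaler_nat (leq_trans (size_scale_leq _ _)) //.
rewrite (leq_trans (size_scale_leq _ _)) // (leq_trans (size_polyMleq _ _)) //.
by rewrite size_polyXn /= addSn -!addnS leq_add2l.
Qed.

Let D_sum i (p : {poly F}) : (size p <= i.+1)%N ->
  D p = \sum_(j < i) D (p`_j *: 'X^j) + D (top_part i p).
Proof.
move=> pi; rewrite -(der_along_sum (j := idfun) (polyder_der v d_der)).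
rewrite -(polyder_der v d_der).1; congr D.
rewrite -(big_ord_recr i (fun j => p`_j *: 'X^j)).
apply/polyP => j; rewrite -poly_def coef_poly; case: ltnP => // ij.
by rewrite nth_default // (leq_trans pi).
Qed.

Lemma size_polyder i (p : {poly F}) :
  (size p <= i.+1)%N -> (size (D p) <= (i + q).+1)%N.
Proof.
move=> pi; rewrite (D_sum pi); apply/(leq_trans (size_polyD _ _)); rewrite geq_max.
rewrite size_D_monomial andbT; apply: (leq_trans (size_sum _ _ _)).
apply/bigmax_leqP => j _; apply: (leq_trans (size_D_monomial _ _)).
by rewrite ltnS leq_add2r ltnW.
Qed.

(** Monomials of degree below [i] are sent to degrees below [i + q], so only the component of degree
    [i] contributes. *)
Lemma top_part_polyder i (p : {poly F}) :
  (size p <= i.+1)%N -> top_part (i + q) (D p) = top_der (top_part i p).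
Proof.
move=> pi; rewrite {1}/top_part (D_sum pi) coefD nth_default ?add0r; last first.
  apply: (leq_trans (size_sum _ _ _)); apply/bigmax_leqP => j _.
  by apply: (leq_trans (size_D_monomial _ _)); rewrite -addSn leq_add2r.
rewrite /top_der !polyder_monomial // coefD coefMXn ltnNge leq_addr /= addKn.
rewrite scalerDl -scalerAl -exprD [(q + i)%N]addnC; congr (_ + _).
rewrite coefMn coefZ; case: i { pi } => [|i]; first by rewrite !mulr0n scale0r.
rewrite addSnnS coefXnM ltnNge leq_addr /= addKn.
rewrite /top_part -scalerAr -exprD scalerA.
by rewrite -!scaler_nat !scalerA -[RHS]/(_ *: _) mulr_natl.
Qed.

Lemma top_part_iter_polyder N i (p : {poly F}) : (size p <= i.+1)%N ->
  (size (iter N D p) <= (i + N * q).+1)%N /\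
  top_part (i + N * q) (iter N D p) = iter N top_der (top_part i p).
Proof.
move=> pi; elim: N => [|N [IH1 IH2]]; first by rewrite addn0.
rewrite !iterS mulSn [(q + _)%N]addnC addnA; split; first exact: size_polyder.
by rewrite top_part_polyder // IH2.
Qed.

(** The iterates of [top_der] on the component are components of the iterates of [D], in degree
    [i + N * q]. *)
Lemma top_part_nilpotent i (p : {poly F}) : (size p <= i.+1)%N ->
  nilpotent_at D p -> nilpotent_at top_der (top_part i p).
Proof.
move=> pi [N pN]; exists N.
by rewrite -(top_part_iter_polyder N pi).2 pN /top_part coef0 scale0r.
Qed.

End Homogenization.

Lemma top_partM (F : idomainType) (a b : nat) (p r : {poly F}) :
  (size p <= a.+1)%N -> (size r <= b.+1)%N ->
  (size (p * r)%R <= (a + b).+1)%N /\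
  top_part (a + b) (p * r) = top_part a p * top_part b r.
Proof.
move=> pa rb; split.
  by apply: (leq_trans (size_polyMleq _ _)); lia.
rewrite /top_part -scalerAl -scalerAr -exprD scalerA; congr (_ *: _).
rewrite coefM (bigD1 (inord a)) //= inordK ?ltnS ?leq_addr // addKn big1 ?addr0 //.
move=> i; rewrite -val_eqE /= inordK ?ltnS ?leq_addr // => ia.
have [ai|] := leqP a.+1 i; first by rewrite [p`_i]nth_default ?mul0r // (leq_trans pa).
move=> ai; rewrite [r`_ _]nth_default ?mulr0 // (leq_trans rb) //; lia.
Qed.

Lemma top_partX (F : idomainType) (a i : nat) (p : {poly F}) :
  (size p <= a.+1)%N ->
  (size (p ^+ i)%R <= (i * a).+1)%N /\
  top_part (i * a) (p ^+ i) = top_part a p ^+ i.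
Proof.
move=> pa; elim: i => [|i [IH1 IH2]].
  rewrite !expr0 mul0n size_poly1; split=> //.
  by rewrite /top_part coefC eqxx expr0 scale1r.
by rewrite !exprS mulSn -IH2; apply: top_partM.
Qed.

(** * Evaluation of polynomials in two variables *)

Section Eval2.

Variables (k : fieldType) (B : comAlgType k) (u v : B).

Lemma eval2_is_additive : zmod_morphism (eval2 u v).
Proof. exact: raddfB. Qed.
HB.instance Definition _ :=
  GRing.isZmodMorphism.Build {mpoly k[2]} B (eval2 u v) eval2_is_additive.

Lemma eval2_is_multiplicative : monoid_morphism (eval2 u v).
Proof. by split=> [|p q]; rewrite /eval2 ?rmorph1 ?rmorphM. Qed.
HB.instance Definition _ :=
  GRing.isMonoidMorphism.Build {mpoly k[2]} B (eval2 u v) eval2_is_multiplicative.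

Lemma eval2C c : eval2 u v c%:MP = c%:A.
Proof. by rewrite /eval2 mmapC. Qed.

Lemma eval2X0 : eval2 u v 'X_ord0 = u.
Proof. by rewrite /eval2 mmapX mmap1U (tnth_nth 0). Qed.

Lemma eval2X1 : eval2 u v 'X_ord_max = v.
Proof. by rewrite /eval2 mmapX mmap1U (tnth_nth 0). Qed.

End Eval2.

Lemma ord2P (i : 'I_2) : i = ord0 \/ i = ord_max.
Proof. by case: i => -[|[|//]] ?; [left | right]; apply: val_inj. Qed.

Lemma mpoly_closed_ind (r : nat) (k : fieldType) (P : {mpoly k[r]} -> Prop) :
  (forall c, P c%:MP) -> (forall i, P 'X_i) ->
  (forall p q, P p -> P q -> P (p + q)) -> (forall p q, P p -> P q -> P (p * q)) ->
  forall p, P p.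
Proof.
move=> PC PX PD PM; elim/mpolyind => [|c mm p _ _ Pp]; first by rewrite -mpolyC0.
apply: PD => //; rewrite -mul_mpolyC; apply: (PM) => //; rewrite mpolyXE_id.
apply: (big_ind P) => [|p1 q1|i _]; [by rewrite -mpolyC1|exact: PM|].
by elim: (mm i) => [|j IH]; rewrite ?exprS ?expr0 -?mpolyC1 //; apply: (PM).
Qed.

(** * The hypersurface algebra inside F[t] *)

Section Core.

Variables (k : fieldType) (n e l m : nat) (B : comAlgType k) (x y z t : B).
Variable f : 'I_m -> {mpoly k[2]}.

Local Notation R2 := {mpoly k[2]}.
Local Notation F := {fraction R2}.
Local Notation ev := (eval2 x z).
Local Notation cst g := (tofrac g)%:P.

Variable iota : {rmorphism B -> {poly F}}.

Definition wpoly : R2 := 'X_ord0 ^+ n + 'X_ord_max ^+ e.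

Hypothesis k_char0 : [pchar k] =i pred0.
Hypotheses (n_gt1 : (1 < n)%N) (e_gt1 : (1 < e)%N).
Hypotheses (l_gt1 : (1 < l)%N) (m_gt1 : (1 < m)%N).
Hypothesis relation :
  y * ev wpoly ^+ l = t ^+ m + \sum_(i < m) ev (f i) * t ^+ (m - i.+1).
(** Generation of [B] by k[x, z], y and t, in the form of an induction principle. *)
Hypothesis B_ind : forall P : B -> Prop,
  (forall p, P (ev p)) -> P y -> P t ->
  (forall a b, P a -> P b -> P (a + b)) -> (forall a b, P a -> P b -> P (a * b)) ->
  forall b, P b.
Hypothesis iota_ev : forall p, iota (ev p) = cst p.
Hypothesis iota_t : iota t = 'X.

Local Notation w := wpoly.

Lemma natr_mpoly_neq0 i : (i.+1%:R : R2) != 0.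
Proof.
rewrite -(rmorph_nat (@mpolyC 2 k)) mpolyC_eq0.
by rewrite ((pcharf0P k).1 k_char0).
Qed.

Lemma natr_F_neq0 i : (i.+1%:R : F) != 0.
Proof. by rewrite -(rmorph_nat (@FracField.tofrac R2)) tofrac_eq0 natr_mpoly_neq0. Qed.

Lemma natr_polyF_neq0 i : (i.+1%:R : {poly F}) != 0.
Proof. by rewrite -polyC_natr polyC_eq0 natr_F_neq0. Qed.

Lemma wpoly_neq0 : w != 0.
Proof.
apply/eqP => /(congr1 (meval (fun i : 'I_2 => (i == ord0)%:R))).
rewrite /wpoly rmorphD !rmorphXn /= !mevalXU rmorph0 eqxx expr1n expr0n.
by rewrite gtn_eqF ?(ltnW e_gt1) //= addr0 meval0 => /eqP; rewrite oner_eq0.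
Qed.

Let W : F := tofrac w ^+ l.

Lemma W_neq0 : W != 0.
Proof. by rewrite expf_neq0 // tofrac_eq0 wpoly_neq0. Qed.

(* The leading form of [iota y] in the grading by degree in ['X]. *)
Definition topY : {poly F} := W^-1 *: 'X^m.

Lemma cst_w : cst (w ^+ l) = W%:P.
Proof. by rewrite rmorphXn. Qed.

Lemma topY_w : topY * cst w ^+ l = 'X^m.
Proof.
rewrite /topY -polyC_exp -scalerAl mulrC mul_polyC scalerA mulVf ?scale1r //.
exact: W_neq0.
Qed.

Lemma topY_neq0 : topY != 0.
Proof. by rewrite scaler_eq0 negb_or invr_eq0 W_neq0 expf_neq0 // polyX_eq0. Qed.

Lemma size_cst (g : R2) : (size (cst g : {poly F}) <= 1)%N.
Proof. exact: size_polyC_leq1. Qed.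

Lemma top_cst (g : R2) : top_part 0 (cst g) = cst g :> {poly F}.
Proof. by rewrite /top_part coefC eqxx expr0 alg_polyC. Qed.

Lemma iota_yE : exists2 r : {poly F},
  (size r <= m)%N & iota y = W^-1 *: ('X^m + r).
Proof.
exists (\sum_(i < m) cst (f i) * 'X^(m - i.+1)).
  apply: (leq_trans (size_sum _ _ _)); apply/bigmax_leqP => i _.
  rewrite mul_polyC (leq_trans (size_scale_leq _ _)) // size_polyXn.
  by have := ltn_ord i; lia.
have := congr1 iota relation.
rewrite rmorphM -rmorphXn iota_ev cst_w rmorphD rmorphXn iota_t rmorph_sum /=.
under eq_bigr => i _ do rewrite rmorphM rmorphXn /= iota_ev iota_t.
by move=> <-; rewrite mulrC mul_polyC scalerA mulVf ?scale1r // W_neq0.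
Qed.

Lemma size_iota_y : (size (iota y) <= m.+1)%N.
Proof.
have [r rm ->] := iota_yE; rewrite (leq_trans (size_scale_leq _ _)) //.
by rewrite (leq_trans (size_polyD _ _)) // geq_max size_polyXn leqnn leqW.
Qed.

Lemma top_iota_y : top_part m (iota y) = topY.
Proof.
have [r rm ->] := iota_yE; rewrite /top_part coefZ coefD coefXn eqxx.
by rewrite [r`_m]nth_default // addr0 mulr1.
Qed.

(** * Normal form over k[x, z] *)

Definition ytmono (i : nat) : B := y ^+ (i %/ m) * t ^+ (i %% m).

Lemma top_ytmono g a b : 
  (size (iota (ev g * (y ^+ a * t ^+ b))%R) <= (a * m + b).+1)%N /\
  top_part (a * m + b) (iota (ev g * (y ^+ a * t ^+ b))) = cst g * (topY ^+ a * 'X^b).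
Proof.
rewrite !rmorphM !rmorphXn /= iota_ev iota_t.
have [sy ty] := top_partX a size_iota_y.
have sX : (size ('X^b : {poly F}) <= b.+1)%N by rewrite size_polyXn.
have tX : top_part b 'X^b = 'X^b :> {poly F}.
  by rewrite /top_part coefXn eqxx scale1r.
have [syX tyX] := top_partM sy sX.
have := top_partM (size_cst g) syX; rewrite add0n => -[-> ->].
by rewrite tyX ty tX top_cst top_iota_y.
Qed.

(** There is exactly one monomial [ytmono i] in each degree i = m a + b with b < m, so [N] also
    bounds the degree in t. *)
Definition spanned N b := exists c : nat -> R2, b = \sum_(i < N) ev (c i) * ytmono i.

Lemma spanned_leq N M b : (N <= M)%N -> spanned N b -> spanned M b.
Proof.
move=> NM [c ->]; exists (fun i => if (i < N)%N then c i else 0).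
rewrite (big_ord_widen_cond M xpredT (fun i => ev (c i) * ytmono i) NM) big_mkcond /=.
by apply: eq_bigr => i _; case: ifP => // _; rewrite rmorph0 mul0r.
Qed.

Lemma spanned_add a b :
  (exists N, spanned N a) -> (exists N, spanned N b) -> exists N, spanned N (a + b).
Proof.
move=> [N aN] [M bM]; exists (maxn N M).
have [c ->] := spanned_leq (leq_maxl N M) aN.
have [c' ->] := spanned_leq (leq_maxr N M) bM.
exists (fun i => c i + c' i); rewrite -big_split; apply: eq_bigr => i _.
by rewrite rmorphD mulrDl.
Qed.

Lemma spanned_scale g b : (exists N, spanned N b) -> exists N, spanned N (ev g * b).
Proof.
move=> [N [c ->]]; exists N, (fun i => g * c i).
by rewrite mulr_sumr; apply: eq_bigr => i _; rewrite rmorphM mulrA.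
Qed.

Lemma spanned0 : exists N, spanned N 0.
Proof. by exists 0%N, (fun=> 0); rewrite big_ord0. Qed.

Lemma spanned_ytmono i : exists N, spanned N (ytmono i).
Proof.
exists i.+1, (fun j => (j == i)%:R); rewrite big_ord_recr /= eqxx big1 ?add0r.
  by rewrite rmorph1 mul1r.
by move=> j _; rewrite ltn_eqF // rmorph0 mul0r.
Qed.

Lemma spanned_yt a b : (b < m)%N -> exists N, spanned N (y ^+ a * t ^+ b).
Proof.
move=> bm; have := spanned_ytmono (a * m + b).
by rewrite /ytmono divnMDl ?(ltnW m_gt1) // divn_small // addn0 modnMDl modn_small.
Qed.

Lemma spanned_sum (I : Type) (r : seq I) (E : I -> B) :
  (forall i, exists N, spanned N (E i)) -> exists N, spanned N (\sum_(i <- r) E i).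
Proof.
move=> rE; apply: (big_ind (fun b => exists N, spanned N b)) => //; first exact: spanned0.
exact: spanned_add.
Qed.

(** The span is a k[x, z]-module, and [B_ind] reduces the claim to multiplication by y, which is
    immediate, and by t. *)
Lemma spanned_mul a b : (exists N, spanned N b) -> exists N, spanned N (a * b).
Proof.
have m_gt0 : (0 < m)%N by apply: ltnW.
move: b; apply: (B_ind (P := fun a => forall b, (exists N, spanned N b) ->
  exists N, spanned N (a * b))) => {a} [p|||a b IHa IHb c cN|a b IHa IHb c cN].
- exact: spanned_scale.
- move=> b [N [c ->]]; rewrite mulr_sumr; apply: spanned_sum => i.
  rewrite mulrCA; apply: spanned_scale; rewrite mulrA -exprS.
  exact/spanned_yt/ltn_pmod.
- move=> b [N [c ->]]; rewrite mulr_sumr; apply: spanned_sum => i.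
  rewrite mulrCA; apply: spanned_scale; rewrite mulrCA -exprS.
  have := ltn_pmod i m_gt0; rewrite leq_eqVlt => /orP[/eqP ->|]; last exact: spanned_yt.
  (* The exponent of t has reached [m]; the relation trades t^m for one more factor y and lower
     powers of t. *)
  rewrite (_ : t ^+ m = y * ev w ^+ l +
      \sum_(i < m) ev (- f i) * t ^+ (m - i.+1)); last first.
    rewrite relation -addrA -big_split /= big1 ?addr0 // => j _.
    by rewrite rmorphN mulNr subrr.
  rewrite mulrDr; apply: spanned_add.
    rewrite mulrA -exprSr mulrC -rmorphXn; apply: spanned_scale.
    by rewrite -[_ ^+ _]mulr1 -(expr0 t); apply: spanned_yt.
  rewrite mulr_sumr; apply: spanned_sum => j; rewrite mulrCA; apply: spanned_scale.
  apply: spanned_yt; lia.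
- by rewrite mulrDl; apply: spanned_add; [apply: IHa | apply: IHb].
- by rewrite -mulrA; apply/IHa/IHb.
Qed.

Lemma spanned_all b : exists N, spanned N b.
Proof.
rewrite -[b]mulr1; apply: spanned_mul; have := spanned_yt 0 (ltnW m_gt1).
by rewrite !expr0 mulr1.
Qed.

Lemma size_spanned N b : spanned N b -> (size (iota b) <= N)%N.
Proof.
move=> [c ->]; rewrite rmorph_sum; apply: (leq_trans (size_sum _ _ _)).
apply/bigmax_leqP => i _.
have [s _] := top_ytmono (c i) (i %/ m) (i %% m).
by apply: (leq_trans s); rewrite -divn_eq.
Qed.

(** Only the last monomial [ytmono N] reaches degree [N]. *)
Lemma spanned_top N b : spanned N.+1 b ->
  exists g b', [/\ spanned N b', b = b' + ev g * ytmono N &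
    top_part N (iota b) = cst g * (topY ^+ (N %/ m) * 'X^(N %% m))].
Proof.
move=> [c ->]; exists (c N), (\sum_(i < N) ev (c i) * ytmono i).
have Nspan : spanned N (\sum_(i < N) ev (c i) * ytmono i) by exists c.
rewrite big_ord_recr /=; split=> //; have [_] := top_ytmono (c N) (N %/ m) (N %% m).
rewrite -divn_eq => <-; rewrite rmorphD /top_part coefD.
by rewrite [X in X + _]nth_default ?add0r // size_spanned.
Qed.

(** A last term beyond the degree of [iota b] has zero component there; as [topY] and 'X are
    non-zero its coefficient vanishes and the term is dropped. *)
Lemma spanned_size b : spanned (size (iota b)) b.
Proof.
have [N] := spanned_all b; elim: N => [|N IH] bN.
  exact: spanned_leq bN.
have [/spanned_leq|bs] := leqP N.+1 (size (iota b)); first exact.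
have [g [b' [b'N bE]]] := spanned_top bN.
rewrite {1}/top_part nth_default // scale0r => /esym/eqP.
rewrite mulf_eq0 polyC_eq0 tofrac_eq0 mulf_eq0 !expf_eq0 (negPf topY_neq0).
rewrite polyX_eq0 !andbF !orbF => /eqP g0.
by apply: IH; rewrite bE g0 rmorph0 mul0r addr0.
Qed.

Lemma iota_inj b : iota b = 0 -> b = 0.
Proof.
move=> b0; have := spanned_size b; rewrite b0 size_poly0 => -[c ->].
by rewrite big_ord0.
Qed.

Lemma iota_degree0 b : (size (iota b) <= 1)%N -> exists g, b = ev g.
Proof.
move=> b1; have [c ->] := spanned_leq b1 (spanned_size b); exists (c 0%N).
by rewrite big_ord1 /ytmono div0n mod0n !expr0 !mulr1.
Qed.

(** This restricts the coefficient of degree [i] on the image of [B]: its denominator is at most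
    W^(i %/ m). *)
Lemma iota_top i b : (size (iota b) <= i.+1)%N -> exists g,
  top_part i (iota b) = cst g * (topY ^+ (i %/ m) * 'X^(i %% m)).
Proof.
move=> bi; have [g [_ [_ _ E]]] := spanned_top (spanned_leq bi (spanned_size b)).
by exists g.
Qed.

(** The relation determines the value at y, because w^l is non-zero in the domain F[t]. *)
Lemma der_along_iota_ext (D1 D2 : B -> {poly F}) :
  derivation_along iota D1 -> derivation_along iota D2 ->
  (forall p, D1 (ev p) = D2 (ev p)) -> D1 t = D2 t -> D1 =1 D2.
Proof.
move=> D1d D2d Dev Dt.
have DM a b : D1 a = D2 a -> D1 b = D2 b -> D1 (a * b) = D2 (a * b).
  by move=> Da Db; rewrite D1d.2 D2d.2 Da Db.
have DX i : D1 (t ^+ i) = D2 (t ^+ i).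
  by rewrite (der_alongX D1d) (der_alongX D2d) Dt.
apply: B_ind => //; last first.
- by move=> a b Da Db; rewrite D1d.1 D2d.1 Da Db.
have : D1 (y * ev (w ^+ l)) = D2 (y * ev (w ^+ l)).
  rewrite rmorphXn relation D1d.1 D2d.1 DX; congr (_ + _).
  rewrite (der_along_sum D1d) (der_along_sum D2d); apply: eq_bigr => i _; exact: DM.
rewrite D1d.2 D2d.2 Dev => /addIr; apply: mulIf.
by rewrite iota_ev polyC_eq0 tofrac_eq0 expf_neq0 // wpoly_neq0.
Qed.


(** * Locally nilpotent derivations kill x and z *)

Section OneLND.

Variable D : LND B.

Lemma lnd_der : derivation_along idfun D.
Proof. by split=> a b; [exact: raddfD | exact: lnd_leibniz]. Qed.

Lemma iota_lnd_der : derivation_along iota (fun b => iota (D b)).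
Proof.
split=> a b /=; first by rewrite lnd_der.1 rmorphD.
by rewrite lnd_der.2 rmorphD !rmorphM.
Qed.

(** Extends [D] to F[t]: its restriction to k[x, z] passes to fractions, and agreement on k[x, z]
    and t is enough. *)
Lemma iota_lnd_polyder : exists d,
  [/\ derivation_along polyC d, forall p, d (tofrac p) = iota (D (ev p)) &
      forall b, iota (D b) = polyder d (iota (D t)) (iota b)].
Proof.
have [|d [dE d_der]] := @derivation_frac R2 {poly F} (@polyC F)
  (fun p => iota (D (ev p))).
  split=> a b /=; first by rewrite rmorphD iota_lnd_der.1.
  by rewrite rmorphM iota_lnd_der.2 !iota_ev.
exists d; split=> // b; move: b; apply: der_along_iota_ext => [|||].
- exact: iota_lnd_der.
- have [DD DM] := polyder_der (iota (D t)) d_der.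
  by split=> a b; rewrite ?rmorphD ?rmorphM ?DD ?DM.
- by move=> p; rewrite iota_ev polyderC // dE.
- by rewrite iota_t polyderX.
Qed.

Lemma lnd_const c : D c%:A = 0.
Proof. by rewrite linearZ /= (der_along1 (j := idfun) lnd_der) scaler0. Qed.



(** Elements of F have degree 0 in t, so the product and quotient rules never exceed the degrees at
    the variables. *)
Lemma size_frac_der (d : F -> {poly F}) N : derivation_along polyC d ->
  (forall c : k, d (tofrac c%:MP) = 0) ->
  (forall i, (size (d (tofrac 'X_i)) <= N)%N) ->
  forall u, (size (d u) <= N)%N.
Proof.
move=> [dD dM] dC dX.
have sizeM (a : F) (r : {poly F}) : (size r <= N)%N -> (size (a%:P * r)%R <= N)%N.
  by rewrite mul_polyC; apply: leq_trans; rewrite size_scale_leq.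
have sizeD (r s : {poly F}) :
    (size r <= N)%N -> (size s <= N)%N -> (size (r + s)%R <= N)%N.
  by move=> rN sN; rewrite (leq_trans (size_polyD _ _)) // geq_max rN.
have d2 (p : R2) : (size (d (tofrac p)) <= N)%N.
  move: p; apply: mpoly_closed_ind => [c|//|p q pN qN|p q pN qN].
  - by rewrite dC size_poly0.
  - by rewrite rmorphD dD sizeD.
  - by rewrite rmorphM dM sizeD // ?[_ * _%:P]mulrC sizeM.
move=> u; have [a [b [bN ub]]] := frac_repr u.
have bF : tofrac b != 0 by rewrite tofrac_eq0.
have := congr1 d ub; rewrite dM => /(canRL (addrK _)) dE.
have -> : d u = (tofrac b)^-1%:P * (d (tofrac a) + (- u)%:P * d (tofrac b)).
  rewrite polyCN mulNr -dE mulrCA -polyCM mulVf // polyC1 mulr1 //.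
by apply/sizeM/sizeD/sizeM.
Qed.

(** The bounds say that [D] raises degrees by at most [q]; [delta] is its component of degree [q],
    nilpotent at components coming from [B]. *)
Lemma lnd_top_der q :
  (size (iota (D x)) <= q.+1)%N -> (size (iota (D z)) <= q.+1)%N ->
  (size (iota (D t)) <= q.+2)%N ->
  exists delta : {poly F} -> {poly F}, [/\ derivation_along idfun delta,
    forall i b, (size (iota b) <= i.+1)%N -> nilpotent_at delta (top_part i (iota b)) &
    forall i b, (size (iota b) <= i.+1)%N -> (size (iota (D b)) <= (i + q).+1)%N /\
      top_part (i + q) (iota (D b)) = delta (top_part i (iota b))].
Proof.
move=> sx sz st; have [d [d_der dE DE]] := iota_lnd_polyder.
have size_d u : (size (d u) <= q.+1)%N.
  apply: size_frac_der d_der _ _ u => [c|i]; rewrite dE.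
    by rewrite eval2C lnd_const rmorph0.
  by have [->|->] := ord2P i; rewrite ?eval2X0 ?eval2X1.
exists (top_der d (iota (D t)) q); split=> [|i b bi|i b bi].
- exact: top_der_der.
- apply: top_part_nilpotent => //.
  have [N DN] := lnd_nilpotent D b; exists N.
  have -> : iter N (polyder d (iota (D t))) (iota b) = iota (iter N D b).
    by elim: (N) => //= j ->.
  by rewrite DN rmorph0.
- by rewrite DE size_polyder // top_part_polyder.
Qed.

Lemma lnd_xz : D x = 0 /\ D z = 0.
Proof.
have m_gt0 := ltnW m_gt1; have l_gt0 := ltnW l_gt1.
set s0 := maxn (size (iota (D x))) (size (iota (D z))).
have [s0_eq0|s0_neq0] := eqVneq s0 0%N.
  have/andP[]: (size (iota (D x)) <= 0)%N && (size (iota (D z)) <= 0)%N.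
    by rewrite -geq_max -/s0 s0_eq0.
  by rewrite !leqn0 !size_poly_eq0 => /eqP/iota_inj -> /eqP/iota_inj ->.
(* Sizes exceed degrees by one: [q] is the least bound with deg D(x), deg D(z) <= q and deg D(t) <=
   q + 1, and s0 > 0 makes it a natural number. *)
exfalso; have [q qE] : exists q, q.+1 = maxn s0 (size (iota (D t))).-1.
  by exists (maxn s0 (size (iota (D t))).-1).-1; rewrite prednK // leq_max lt0n s0_neq0.
have /andP[sx sz] : (size (iota (D x)) <= q.+1)%N && (size (iota (D z)) <= q.+1)%N.
  by rewrite -geq_max -/s0 qE leq_maxl.
have st : (size (iota (D t)) <= q.+2)%N.
  by have := leq_maxr s0 (size (iota (D t))).-1; rewrite -qE; lia.
have [delta [delta_der top_nil topD]] := lnd_top_der sx sz st.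
have top_delta i b : (size (iota b) <= i.+1)%N -> exists g,
    delta (top_part i (iota b)) = cst g * (topY ^+ ((i + q) %/ m) * 'X^((i + q) %% m)).
  by move=> /topD[Db <-]; apply: iota_top.
have nil_mono g a b : nilpotent_at delta (cst g * (topY ^+ a * 'X^b)).
  by have [? <-] := top_ytmono g a b; apply: top_nil.
have top_t : top_part 1 (iota t) = 'X by rewrite iota_t /top_part coefX scale1r.
have nil_cst g : nilpotent_at delta (cst g).
  by have := top_nil 0%N (ev g); rewrite iota_ev top_cst; apply; apply: size_cst.
have nilY : nilpotent_at delta topY.
  by rewrite -top_iota_y; apply/top_nil/size_iota_y.
have nilX : nilpotent_at delta 'X.
  by rewrite -top_t; apply: top_nil; rewrite iota_t size_polyX.
have char0 := natr_polyF_neq0.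
(* delta(Y) has degree m + q >= m, so its form given by [iota_top] contains a factor [topY]. *)
have deltaY : delta topY = 0.
  have [g] := top_delta m y size_iota_y.
  rewrite top_iota_y -[in (m + q)%N](mul1n m) divnMDl // modnMDl exprD expr1 => gE.
  apply: (derivation_dvd char0 delta_der nilY (nil_mono g (q %/ m)%N (q %% m)%N)).
  by rewrite gE -mulrA mulrCA.
have wN : cst w != 0 :> {poly F} by rewrite polyC_eq0 tofrac_eq0 wpoly_neq0.
(* Apply [delta] to 'X^m = Y w^l, where delta(Y) = 0. *)
have deltaYw : 'X^(m.-1) * delta 'X *+ m = topY * (cst w ^+ l.-1 * delta (cst w)) *+ l.
  rewrite -(der_alongX (j := idfun) delta_der) /= -topY_w delta_der.2 deltaY mul0r add0r /=.
  by rewrite (der_alongX (j := idfun) delta_der) mulrnAr.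
have deltaw : delta (cst w) = 0.
  have := ltn_pmod q m_gt0; rewrite leq_eqVlt => /orP[/eqP qm|qm].
    (* Case q = -1 modulo m: delta(w), of degree q, is a multiple of 'X^(m-1). *)
    have [|g] := top_delta 0%N (ev w); first by rewrite iota_ev size_cst.
    rewrite iota_ev top_cst add0n (_ : q %% m = m.-1)%N; last first.
      by apply: succn_inj; rewrite qm prednK.
    rewrite mulrA.
    apply: (derivation_modification char0 delta_der m_gt1 l_gt1) => //.
    - by rewrite polyX_eq0.
    - by rewrite topY_w.
  (* Otherwise q + 1 is not divisible by m, so delta('X), of degree q + 1, keeps a factor 'X. *)
  have deltaX : delta 'X = 0.
    have [|g] := top_delta 1%N t; first by rewrite iota_t size_polyX.
    rewrite top_t add1n => gE.
    apply: (derivation_dvd char0 delta_der nilX (nil_mono g (q %/ m)%N (q %% m)%N)).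
    rewrite gE; have -> : (q.+1 = (q %/ m) * m + (q %% m).+1)%N by rewrite addnS -divn_eq.
    rewrite divnMDl // modnMDl (divn_small qm) (modn_small qm) addn0 exprS.
    by rewrite (mulrCA (topY ^+ _) 'X) (mulrCA (cst g) 'X).
  move/eqP: deltaYw; rewrite deltaX mulr0 mul0rn eq_sym -mulr_natr !mulf_eq0.
  rewrite (negPf topY_neq0) expf_eq0 (negPf wN) andbF /= -(prednK l_gt0).
  by rewrite (negPf (char0 _)) orbF => /eqP.
have wE : cst w = cst 'X_ord0 ^+ n + cst 'X_ord_max ^+ e :> {poly F}.
  by rewrite /wpoly rmorphD !rmorphXn polyCD !polyC_exp.
have [dx dz] : delta (cst 'X_ord0) = 0 /\ delta (cst 'X_ord_max) = 0.
  by apply: (derivation_power_sum char0 delta_der n_gt1 e_gt1); rewrite -?wE.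
have deltaX : delta 'X = 0.
  move/eqP: deltaYw; rewrite deltaw !mulr0 mul0rn -mulr_natr !mulf_eq0.
  rewrite expf_eq0 polyX_eq0 andbF /= -(prednK m_gt0).
  by rewrite (negPf (char0 _)) orbF => /eqP.
(* Where [delta] kills the component of degree [i], the degree bound on D(b) improves by one. *)
have vanish i b : (size (iota b) <= i.+1)%N -> delta (top_part i (iota b)) = 0 ->
    (size (iota (D b)) <= i + q)%N.
  move=> /topD[Db <-] /eqP; rewrite scaler_eq0 expf_eq0 polyX_eq0 andbF orbF => /eqP b0.
  apply/leq_sizeP => j; rewrite leq_eqVlt => /orP[/eqP <- //|ij].
  by apply: nth_default; apply: leq_trans ij.
(* The improved bounds at x, z and t contradict the minimality of [q]. *)
have: (q.+1 <= q)%N.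
  rewrite {1}qE !geq_max -andbA; apply/and3P; split.
  - have iota_x : iota x = cst 'X_ord0 by rewrite -iota_ev eval2X0.
    by have := vanish 0%N x; rewrite iota_x top_cst; apply; rewrite ?size_cst.
  - have iota_z : iota z = cst 'X_ord_max by rewrite -iota_ev eval2X1.
    by have := vanish 0%N z; rewrite iota_z top_cst; apply; rewrite ?size_cst.
  - have := vanish 1%N t; rewrite top_t deltaX iota_t size_polyX add1n.
    by move=> /(_ isT erefl); lia.
by rewrite ltnn.
Qed.

End OneLND.

(** * Shape of the locally nilpotent derivations *)

Lemma lnd_ev (D : LND B) p : D (ev p) = 0.
Proof.
have [Dx Dz] := lnd_xz D; have [DD DM] := lnd_der D.
move: p; apply: mpoly_closed_ind => [c|i|p p' Dp Dp'|p p' Dp Dp'].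
- by rewrite eval2C lnd_const.
- by have [->|->] := ord2P i; rewrite ?eval2X0 ?eval2X1.
- by rewrite rmorphD DD Dp Dp' addr0.
- by rewrite rmorphM DM Dp Dp' mul0r mulr0 addr0.
Qed.

(** Both sides are derivations along [iota] that vanish on k[x, z] and agree at t. *)
Lemma iota_lnd (D : LND B) b : iota (D b) = (iota b)^`() * iota (D t).
Proof.
move: b; apply: der_along_iota_ext => [|||].
- exact: iota_lnd_der.
- split=> a b; first by rewrite rmorphD derivD mulrDl.
  by rewrite rmorphM derivM mulrDl mulrAC mulrA.
- by move=> p; rewrite lnd_ev rmorph0 iota_ev derivC mul0r.
- by rewrite iota_t derivX mul1r.
Qed.

Lemma deriv_eq0_size (r : {poly F}) : r^`() = 0 -> (size r <= 1)%N.
Proof.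
move=> r0; apply/leq_sizeP => -[//|i] _; apply/eqP.
have /eqP : r^`()`_i = 0 by rewrite r0 coef0.
by rewrite coef_deriv -mulr_natr mulf_eq0 (negPf (natr_F_neq0 i)) orbF.
Qed.

(** If D(t) had positive degree, r -> r' D(t) would not lower the degree of a non-constant r, so no
    iterate of [D] could kill t. *)
Lemma lnd_t_ev (D : LND B) : exists g, D t = ev g.
Proof.
apply: iota_degree0; rewrite leqNgt; apply/negP => vN.
have vN0 : iota (D t) != 0 by rewrite -size_poly_gt0 (ltn_trans _ vN).
have [N DN] := lnd_nilpotent D t.
suff: (1 < size (iota (iter N D t)))%N by rewrite DN rmorph0 size_poly0.
elim: N {DN} => [|N IH]; first by rewrite /= iota_t size_polyX.
rewrite iterS iota_lnd; have r'N : (iota (iter N D t))^`() != 0.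
  by apply: contraTneq IH => /deriv_eq0_size; rewrite -leqNgt.
rewrite size_mul // ltn_predRL; apply: (@leq_add 1 2) => //.
by rewrite size_poly_gt0.
Qed.

(** D(y) has degree at most m - 1, where [iota_top] allows no denominator; yet its coefficient there
    is m p / w^l for D(t) = p. *)
Lemma lnd_t (D : LND B) : exists g, D t = ev g * ev w ^+ l.
Proof.
have [p Dt] := lnd_t_ev D.
have Dy : iota (D y) = (iota y)^`() * cst p by rewrite iota_lnd Dt iota_ev.
have m_gt0 : (0 < m)%N := ltnW m_gt1.
have sDy : (size (iota (D y)) <= m.-1.+1)%N.
  rewrite prednK // Dy mulrC mul_polyC (leq_trans (size_scale_leq _ _)) //.
  have := size_iota_y; case: (ltnP 0 (size (iota y))) => [y0|].
    rewrite size_poly_gt0 in y0; move=> ym.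
    by rewrite -ltnS (leq_trans (lt_size_deriv y0)).
  by rewrite size_poly_leq0 => /eqP -> _; rewrite deriv0 size_poly0.
have pm : (m.-1 < m)%N by rewrite prednK.
have topE : topY ^+ (m.-1 %/ m) * 'X^(m.-1 %% m) = 'X^(m.-1).
  by rewrite (divn_small pm) (modn_small pm) expr0 mul1r.
have [g gE] := iota_top sDy.
have := congr1 (coefp m.-1) (etrans gE (congr1 ( *%R (cst g)) topE)).
move=> {gE} /=.
rewrite /top_part coefZ coefXn eqxx mulr1 coefCM coefXn eqxx mulr1.
rewrite Dy coefMC coef_deriv prednK //.
have -> : (iota y)`_m = W^-1.
  have := congr1 (coefp m) top_iota_y; rewrite /= /top_part /topY !coefZ coefXn eqxx.
  by rewrite !mulr1.
move=> gE; have pE : p *+ m = w ^+ l * g.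
  apply/eqP; rewrite -tofrac_eq rmorphM rmorphXn rmorphMn /= -/W -gE mulrnAl mulrnAr.
  by rewrite mulVKf // W_neq0.
have mN : m%:R != 0 :> k by rewrite ((pcharf0P k).1 k_char0) -lt0n.
exists (m%:R^-1 *: g).
rewrite Dt -rmorphXn -rmorphM; congr eval2.
by rewrite -scalerAl [g * _]mulrC -pE -scaler_nat scalerA mulVf ?scale1r.
Qed.

(** By [iota_lnd], both derivations are multiples of the derivative in t, so comparing them at t
    suffices. *)
Lemma lnd_multiple (d D : LND B) : d t = ev w ^+ l ->
  exists p, forall b, D b = ev p * d b.
Proof.
move=> dt; have [g Dt] := lnd_t D; exists g => b.
apply/eqP; rewrite -subr_eq0; apply/eqP/iota_inj.
rewrite rmorphB; apply/eqP; rewrite subr_eq0; apply/eqP.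
by rewrite iota_lnd Dt rmorphM mulrCA -dt -iota_lnd -rmorphM.
Qed.

(** The single derivation [d] already cuts out k[x, z]: d(b) = 0 forces [iota b] to have degree 0 in
    t. *)
Lemma lnd_ML (d : LND B) b : d t = ev w ^+ l ->
  ML b <-> exists p, b = ev p.
Proof.
move=> dt; split=> [Mb|[p ->] D]; last exact: lnd_ev.
apply: iota_degree0; apply: deriv_eq0_size.
have /eqP := congr1 iota (Mb d); rewrite rmorph0 iota_lnd dt mulf_eq0.
rewrite -rmorphXn iota_ev polyC_eq0 tofrac_eq0 expf_eq0 (negPf wpoly_neq0) andbF.
by rewrite orbF => /eqP.
Qed.

(** The factor p is a non-zero constant of [d], so D^i = p^i d^i. *)
Lemma iter_lnd_eq0 (d D : LND B) p : ~ (D =1 \0) -> (forall b, D b = ev p * d b) ->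
  forall i b, (iter i D b == 0) = (iter i d b == 0).
Proof.
move=> DN DE i b.
have pN : cst p != 0 :> {poly F}.
  apply/negP; rewrite polyC_eq0 tofrac_eq0 => /eqP p0; apply: DN => c.
  by rewrite DE p0 rmorph0 mul0r.
have -> : iter i D b = ev p ^+ i * iter i d b.
  elim: i => [|i IH]; first by rewrite mul1r.
  rewrite !iterS IH DE (lnd_leibniz d) -rmorphXn lnd_ev mul0r add0r.
  by rewrite rmorphXn exprS mulrA.
have iota_eq0 c : (c == 0) = (iota c == 0).
  by apply/eqP/eqP => [->|/iota_inj //]; rewrite rmorph0.
by rewrite !iota_eq0 rmorphM rmorphXn /= iota_ev mulf_eq0 expf_eq0 (negPf pN) andbF.
Qed.

Lemma lnd_semi_rigid (d : LND B) : d t = ev w ^+ l -> semi_rigid B.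
Proof.
move=> dt D E DN EN b; rewrite /lnd_deg; case: eqP => // _; congr Some.
have [p Dp] := lnd_multiple D dt; have [r Er] := lnd_multiple E dt.
apply: eq_ex_minn => i.
by rewrite (iter_lnd_eq0 DN Dp) (iter_lnd_eq0 EN Er).
Qed.

End Core.

(** * Embedding of the quotient algebra *)

Section QuotientLift.

Variables (k : fieldType) (A : comAlgType k) (g : A) (S : comNzRingType).
Hypothesis g_proper : 1 \notin principal_pred g.
Variable phi : {rmorphism A -> S}.
Hypothesis phi_g : phi g = 0.

(** Universal property of the quotient: chosen representatives are mapped by [phi], and phi(g) = 0
    makes the choice irrelevant. *)
Lemma quot_lift_exists : exists psi : {rmorphism principal_quot g_proper -> S},
  forall p, psi (proj g_proper p) = phi p.
Proof.
pose Q := principal_quot g_proper.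
have [psi psiE] : exists psi : Q -> S, forall p, psi (proj g_proper p) = phi p.
  have /boolp.choice[rep repE] := @proj_surj _ _ _ g_proper.
  exists (phi \o rep) => p /=; have /proj_eq[r E] := repE (proj g_proper p).
  by apply/esym/eqP; rewrite -subr_eq0 -rmorphB E rmorphM /= phi_g mulr0.
have psiB : zmod_morphism psi.
  move=> a b; have [p ->] := proj_surj a; have [q ->] := proj_surj b.
  by rewrite -rmorphB !psiE rmorphB.
have psiM : monoid_morphism psi.
  split=> [|a b]; first by rewrite -(rmorph1 (proj g_proper)) psiE rmorph1.
  have [p ->] := proj_surj a; have [q ->] := proj_surj b.
  by rewrite -rmorphM !psiE rmorphM.
pose psi_add := GRing.isZmodMorphism.Build Q S psi psiB.
pose psi_mul := GRing.isMonoidMorphism.Build Q S psi psiM.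
pose psi_rm : {rmorphism Q -> S} := HB.pack psi psi_add psi_mul.
by exists psi_rm.
Qed.

End QuotientLift.

Lemma mpoly2_rmorph_ext (k : fieldType) (S : nzRingType)
    (phi psi : {rmorphism {mpoly k[2]} -> S}) :
  (forall c, phi c%:MP = psi c%:MP) -> phi 'X_ord0 = psi 'X_ord0 ->
  phi 'X_ord_max = psi 'X_ord_max -> phi =1 psi.
Proof.
move=> EC E0 E1; apply: mpoly_closed_ind => [//|i|p q Ep Eq|p q Ep Eq].
- by have [->|->] := ord2P i.
- by rewrite !rmorphD Ep Eq.
- by rewrite !rmorphM Ep Eq.
Qed.

Lemma eval2_wpoly (k : fieldType) (A : comAlgType k) (u v : A) n e :
  eval2 u v (wpoly k n e) = u ^+ n + v ^+ e.
Proof. by rewrite /wpoly rmorphD !rmorphXn /= eval2X0 eval2X1. Qed.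

Lemma scale_polyCVK (K : fieldType) (c : K) (p : {poly K}) :
  c != 0 -> c^-1 *: p * c%:P = p.
Proof. by move=> c0; rewrite mulrC mul_polyC scalerA divff // scale1r. Qed.

Section Embedding.

Variables (k : fieldType) (n e l m : nat) (e_gt1 : (1 < e)%N).
Variable f : 'I_m -> {mpoly k[2]}.
Local Notation F := {fraction {mpoly k[2]}}.
Local Notation cst g := (tofrac g)%:P.
Local Notation pi := (Bproj n l e_gt1 f).
Local Notation x := (pi (pX k)).
Local Notation y := (pi (pY k)).
Local Notation z := (pi (pZ k)).
Local Notation t := (pi (pT k)).

Lemma Bproj_eval2 p : pi (eval2 (pX k) (pZ k) p) = eval2 x z p.
Proof.
apply: (mpoly2_rmorph_ext (phi := pi \o eval2 (pX k) (pZ k))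
   (psi := eval2 x z)) => [c||] /=.
- by rewrite !eval2C linearZ /= rmorph1.
- by rewrite !eval2X0.
- by rewrite !eval2X1.
Qed.

Lemma Bproj_relation : y * eval2 x z (wpoly k n e) ^+ l =
  t ^+ m + \sum_(i < m) eval2 x z (f i) * t ^+ (m - i.+1).
Proof.
have : pi (Bpoly n e l f) = 0.
  rewrite -(rmorph0 pi); apply/proj_eq; exists 1; by rewrite subr0 mul1r.
rewrite /Bpoly rmorphB => /eqP; rewrite subr_eq0 => /eqP.
rewrite rmorphM /Qpoly rmorphD rmorph_sum !rmorphXn rmorphD !rmorphXn /=.
under eq_bigr => i _ do rewrite rmorphM rmorphXn /= Bproj_eval2.
by rewrite eval2_wpoly.
Qed.

Lemma Bproj_ind (P : Balg n l e_gt1 f -> Prop) :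
  (forall p, P (eval2 x z p)) -> P y -> P t ->
  (forall a b, P a -> P b -> P (a + b)) -> (forall a b, P a -> P b -> P (a * b)) ->
  forall b, P b.
Proof.
move=> Pev Py Pt PD PM b; have [p ->] := proj_surj b.
rewrite -[proj _ p]/(pi p).
move: p; apply: mpoly_closed_ind => [c|i|p q Pp Pq|p q Pp Pq].
- have -> : pi c%:MP = eval2 x z c%:MP.
    by rewrite eval2C -[X in pi X]mulr1 mul_mpolyC linearZ /= rmorph1.
  exact: Pev.
- case: i => -[|[|[|[|//]]]] i4.
  + have -> : Ordinal i4 = inord 0 by apply: val_inj; rewrite /= inordK.
    by rewrite -(eval2X0 x z); apply: Pev.
  + by have -> : Ordinal i4 = inord 1 by apply: val_inj; rewrite /= inordK.
  + have -> : Ordinal i4 = inord 2 by apply: val_inj; rewrite /= inordK.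
    by rewrite -(eval2X1 x z); apply: Pev.
  + by have -> : Ordinal i4 = inord 3 by apply: val_inj; rewrite /= inordK.
- by rewrite rmorphD; apply: (PD).
- by rewrite rmorphM; apply: (PM).
Qed.

(** X and Z go to constants, T to the variable and Y to Q / w^l, the value that annihilates the
    defining polynomial. *)
Lemma Bproj_embedding : exists iota : {rmorphism Balg n l e_gt1 f -> {poly F}},
  (forall p, iota (eval2 x z p) = cst p) /\ iota t = 'X.
Proof.
pose W : F := tofrac (wpoly k n e) ^+ l.
pose Qp : {poly F} := 'X^m + \sum_(i < m) cst (f i) * 'X^(m - i.+1).
pose v (i : 'I_4) : {poly F} := match (i : nat) with
  | 0 => cst 'X_ord0 | 1 => W^-1 *: Qp | 2 => cst 'X_ord_max | _ => 'X end.
have [phi [phiC phiX]] : exists phi : {rmorphism {mpoly k[4]} -> {poly F}},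
    (forall c, phi c%:MP = cst c%:MP) /\ (forall i, phi 'X_i = v i).
  exists (mmap (polyC \o tofrac \o @mpolyC 2 k) v).
  by split=> [c|i] /=; [rewrite mmapC | rewrite mmapX mmap1U].
have vX : phi (pX k) = cst 'X_ord0 by rewrite phiX /v inordK.
have vY : phi (pY k) = W^-1 *: Qp by rewrite phiX /v inordK.
have vZ : phi (pZ k) = cst 'X_ord_max.
  by rewrite phiX /v inordK; [reflexivity |].
have vT : phi (pT k) = 'X by rewrite phiX /v inordK.
have phi_ev p : phi (eval2 (pX k) (pZ k) p) = cst p.
  apply: (mpoly2_rmorph_ext (phi := phi \o eval2 (pX k) (pZ k))
    (psi := polyC \o tofrac)) => [c||] /=.
  - have cA : c%:A = c%:MP :> {mpoly k[4]} by rewrite -mul_mpolyC mulr1.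
    rewrite eval2C cA; exact: phiC.
  - rewrite eval2X0; exact: vX.
  - rewrite eval2X1; exact: vZ.
have phi_Q : phi (Qpoly f) = Qp.
  rewrite /Qpoly rmorphD rmorphXn rmorph_sum /= vT; congr (_ + _).
  by apply: eq_bigr => i _; rewrite rmorphM rmorphXn /= phi_ev vT.
have phi_w : phi (pX k ^+ n + pZ k ^+ e) = cst (wpoly k n e).
  rewrite -(eval2_wpoly (pX k) (pZ k) n e).
  exact: phi_ev.
have WN : W != 0 by rewrite expf_neq0 // tofrac_eq0 wpoly_neq0.
have phi_g : phi (Bpoly n e l f) = 0.
  rewrite /Bpoly rmorphB rmorphM rmorphXn /= phi_Q phi_w vY.
  have -> : cst (wpoly k n e) ^+ l = W%:P by rewrite /W polyC_exp.
  rewrite (scale_polyCVK Qp WN); exact: subrr.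
have [psi psiE] := quot_lift_exists (Bpoly_proper n l f e_gt1) phi_g.
exists psi; split=> [p|]; last by rewrite -vT -psiE.
by rewrite -Bproj_eval2 -phi_ev -psiE.
Qed.

End Embedding.

Theorem proposition4p2 (k : fieldType) (k_char0 : [pchar k] =i pred0)
    (n e l m : nat) (n_gt1 : (1 < n)%N) (e_gt1 : (1 < e)%N)
    (l_gt1 : (1 < l)%N) (m_gt1 : (1 < m)%N)
    (f : 'I_m -> {mpoly k[2]}) :
  let B := Balg n l e_gt1 f in
  let pi : {lrmorphism {mpoly k[4]} -> B} := Bproj n l e_gt1 f in
  let x := pi (pX k) in let y := pi (pY k) in
  let z := pi (pZ k) in let t := pi (pT k) in
  forall d : LND B,
    d x = 0 -> d z = 0 ->
    d y = pi (ddT (Qpoly f)) -> d t = (x ^+ n + z ^+ e) ^+ l ->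
  ((forall b : B, ML b <-> exists p : {mpoly k[2]}, b = eval2 x z p)
     /\ semi_rigid B)
  /\ (forall D : LND B, exists p : {mpoly k[2]},
        forall b : B, D b = eval2 x z p * d b).
Proof.
move=> B pi x y z t d _ _ _ dt.
have [iota [iota_ev iota_t]] := Bproj_embedding n l e_gt1 f.
have rel := Bproj_relation n l e_gt1 f.
have ind := @Bproj_ind k n e l m e_gt1 f.
have dw : d t = eval2 x z (wpoly k n e) ^+ l.
  by rewrite dt eval2_wpoly.
split; first split=> [b|].
- exact: (lnd_ML k_char0 n_gt1 e_gt1 l_gt1 m_gt1 rel ind iota_ev iota_t b dw).
- exact: (lnd_semi_rigid k_char0 n_gt1 e_gt1 l_gt1 m_gt1 rel ind iota_ev iota_t dw).
- move=> D.
  exact: (lnd_multiple k_char0 n_gt1 e_gt1 l_gt1 m_gt1 rel ind iota_ev iota_t D dw).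
Qed.
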